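(* Every quasisymmetric map $F:(\mathbb{R}^2,D)\to(\mathbb{R}^2,D)$ is a biLipschitz map (with respect to $D$). Furthermore, a bijection $F:(\mathbb{R}^2,D)\to(\mathbb{R}^2,D)$ is a quasisymmetric map if and only if it has the following form: $F(x,y)=(ax+c(y),\,ay+b)$ for all $(x,y)\in\mathbb{R}^2$, where $a\neq 0$ and $b$ are real constants and $c:\mathbb{R}\to\mathbb{R}$ is a Lipschitz map (with respect to the Euclidean metric on $\mathbb{R}$).
   Context: $D$ is the quasimetric on $\mathbb{R}^2$ given by $D((x_1,y_1),(x_2,y_2))=\max\{|y_2-y_1|,\ |(x_2-x_1)-(y_2-y_1)\ln|y_2-y_1||\}$, where $0\ln 0$ is understood to be $0$. A quasimetric $\rho$ on a set $A$ is a symmetric function $\rho:A\times A\to[0,\infty)$ with $\rho(x,y)=0$ iff $x=y$ and such that for some $M\ge1$, $\rho(x,z)\le M(\rho(x,y)+\rho(y,z))$ for all $x,y,z\in A$. Let $\eta:[0,\infty)\to[0,\infty)$ be a homeomorphism. A bijection $F:X\to Y$ between quasimetric spaces is $\eta$-quasisymmetric if for all distinct triples $x,y,z\in X$, $\frac{d(F(x),F(y))}{d(F(x),F(z))}\le\eta\left(\frac{d(x,y)}{d(x,z)}\right)$; it is quasisymmetric if it is $\eta$-quasisymmetric for some such $\eta$. A bijection $F:X\to Y$ of quasimetric spaces is biLipschitz if there is $L\ge1$ with $d(x,y)/L\le d(F(x),F(y))\le L\,d(x,y)$ for all $x,y\in X$. *)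

(* Defs.v *)
From HB Require Import structures.
From mathcomp Require Import all_boot all_order all_algebra.
From mathcomp Require Import all_classical all_reals all_analysis.
From mathcomp Require Import ring lra.
Set Implicit Arguments.
Unset Strict Implicit.
Unset Printing Implicit Defensive.
Import Order.TTheory GRing.Theory Num.Theory.
Import numFieldNormedType.Exports.
Local Open Scope classical_set_scope.
Local Open Scope ring_scope.

Definition is_quasimetric (R : realType) (A : Type) (rho : A -> A -> R) : Prop :=
  [/\ forall x y, 0 <= rho x y,
      forall x y, rho x y = rho y x,
      forall x y, rho x y = 0 <-> x = y
    & exists2 M : R, 1 <= M &
        forall x y z, rho x z <= M * (rho x y + rho y z)].

Record quasimetric (R : realType) (A : Type) := Quasimetric {
  qdist :> A -> A -> R;
  qdistP : is_quasimetric qdist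
}.

(* The values of f outside A (and of its inverse g outside B) play no role:
   this says that f restricts to a homeomorphism from A onto B. *)
Definition homeomorphism_on (S T : topologicalType) (A : set S) (B : set T)
    (f : S -> T) : Prop :=
  exists g : T -> S,
    [/\ set_fun A B f, set_fun B A g,
        {in A, cancel f g} /\ {in B, cancel g f},
        {within A, continuous f} & {within B, continuous g}].

Definition nonneg_reals (R : realType) : set R := [set t | 0 <= t].

Definition eta_quasisymmetric (R : realType) (X Y : Type)
    (dX : quasimetric R X) (dY : quasimetric R Y)
    (eta : R -> R) (F : X -> Y) : Prop :=
  bijective F /\
  forall x y z : X, x <> y -> y <> z -> x <> z ->
    dY (F x) (F y) / dY (F x) (F z) <= eta (dX x y / dX x z).

Definition quasisymmetric (R : realType) (X Y : Type)
    (dX : quasimetric R X) (dY : quasimetric R Y) (F : X -> Y) : Prop :=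
  exists eta : R -> R,
    homeomorphism_on (@nonneg_reals R) (@nonneg_reals R) eta /\
    eta_quasisymmetric dX dY eta F.

Definition biLipschitz (R : realType) (X Y : Type)
    (dX : quasimetric R X) (dY : quasimetric R Y) (F : X -> Y) : Prop :=
  bijective F /\
  exists2 L : R, 1 <= L &
    forall x y : X, dX x y / L <= dY (F x) (F y) /\
                    dY (F x) (F y) <= L * dX x y.

(* ln is total (ln 0 = 0), so the convention 0 ln 0 = 0 holds. *)
Definition D_fun (R : realType) (p q : R * R) : R :=
  Num.max `|q.2 - p.2|
          `|(q.1 - p.1) - (q.2 - p.2) * ln `|q.2 - p.2| |.

Lemma xlnx_bound (R : realType) (m z : R) :
  0 < m -> `|z| <= 2 * m -> `|z * ln `|z| - z * ln m| <= 2 * m.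
Proof.
move=> m0 zm; have [->|z0] := eqVneq z 0.
  by rewrite !mul0r subrr normr0; lra.
rewrite -mulrBr normrM.
have z1 : 0 < `|z| by rewrite normr_gt0.
have lnE u : 0 < u -> ln u <= u - 1 :> R.
  move=> u0; have := @le_ln1Dx R (u - 1).
  by have -> : 1 + (u - 1) = u; [ring | apply; lra].
have h1 : ln `|z| - ln m <= `|z| / m - 1.
  by rewrite -ln_div ?posrE//; apply: lnE; apply: divr_gt0.
have h2 : ln m - ln `|z| <= m / `|z| - 1.
  by rewrite -ln_div ?posrE//; apply: lnE; apply: divr_gt0.
have h3 : `|z| / m <= 2 by rewrite ler_pdivrMr.
have e : `|z| * (m / `|z|) = m by rewrite mulrC divfK// gt_eqF.
have h4 : `|z| * (ln m - ln `|z|) <= m - `|z|.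
  have : `|z| * (ln m - ln `|z|) <= `|z| * (m / `|z| - 1) by rewrite ler_pM2l.
  by rewrite [leRHS]mulrBr e mulr1.
have [h|h] := ger0P (ln `|z| - ln m).
  have : `|z| * (ln `|z| - ln m) <= `|z| * 1 by rewrite ler_pM2l//; lra.
  by lra.
rewrite opprB; lra.
Qed.

Lemma D_is_quasimetric (R : realType) : is_quasimetric (@D_fun R).
Proof.
split.
- by move=> x y; rewrite /D_fun le_max normr_ge0.
- move=> x y; rewrite /D_fun (distrC y.2); congr (Num.max _ _).
  by rewrite -[LHS]normrN; congr (`| _ |); ring.
- move=> [x1 x2] [y1 y2]; rewrite /D_fun /=; split=> [|[-> ->]]; last first.
    by rewrite !subrr mul0r subr0 normr0 maxxx.
  move=> e.
  have : `|y2 - x2| <= 0 by rewrite -e le_max lexx.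
  rewrite normr_le0 => /eqP e2.
  have : `|y1 - x1| <= 0.
    by rewrite -e e2 mul0r subr0 le_max lexx orbT.
  rewrite normr_le0 => /eqP e1.
  by congr pair; lra.
- exists 7; first lra.
  move=> [x1 x2] [y1 y2] [z1 z2]; rewrite /D_fun /=.
  set s := y2 - x2; set t := z2 - y2.
  have -> : z2 - x2 = s + t by rewrite /s /t; ring.
  set A := Num.max _ (`|_ - s * _|); set B := Num.max _ (`|_ - t * _|).
  have A1 : `|s| <= A by rewrite le_max lexx.
  have A2 : `|y1 - x1 - s * ln `|s| | <= A by rewrite le_max lexx orbT.
  have B1 : `|t| <= B by rewrite le_max lexx.
  have B2 : `|z1 - y1 - t * ln `|t| | <= B by rewrite le_max lexx orbT.
  have s0 := normr_ge0 s; have t0 := normr_ge0 t.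
  have st := ler_normD s t.
  rewrite ge_max; apply/andP; split; first lra.
  have [m0|m0] := leP (`|s| + `|t|) 0.
    have : `|s| <= 0 by lra.
    have : `|t| <= 0 by lra.
    rewrite !normr_le0 => /eqP t00 /eqP s00.
    move: A2 B2; rewrite t00 s00 addr0 !mul0r !subr0.
    have := ler_normD (y1 - x1) (z1 - y1).
    have -> : y1 - x1 + (z1 - y1) = z1 - x1 by ring.
    lra.
  set m := `|s| + `|t| in m0.
  have mE : m = `|s| + `|t| by [].
  have bs : `|s * ln `|s| - s * ln m| <= 2 * m by apply: xlnx_bound; lra.
  have bt : `|t * ln `|t| - t * ln m| <= 2 * m by apply: xlnx_bound; lra.
  have bw : `|(s + t) * ln `|s + t| - (s + t) * ln m| <= 2 * m.
    by apply: xlnx_bound; lra.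
  move: bs bt bw A2 B2; rewrite !ler_norml mulrDl [(s + t) * ln m]mulrDl.
  lra.
Qed.

Definition D (R : realType) : quasimetric R (R * R) :=
  Quasimetric (@D_is_quasimetric R).

(* Main.v *)
Require Import Defs.
From HB Require Import structures.
From mathcomp Require Import all_boot all_order all_algebra.
From mathcomp Require Import all_classical all_reals all_analysis.
From mathcomp Require Import measurable_realfun.
From mathcomp Require Import ring lra zify.
Import Order.TTheory GRing.Theory Num.Theory.
Import numFieldNormedType.Exports.
Local Open Scope classical_set_scope.
Local Open Scope ring_scope.

Set Implicit Arguments.
Unset Strict Implicit.
Unset Printing Implicit Defensive.

(** Write [E v = v ln |v|] (the function [xlnx] below), so that [D p q] is the
    maximum of [|v|] and [|u - E v|], where [(u, v) = q - p]. Horizontal lines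
    carry the Euclidean distance, whereas the distance from the origin to the
    row of height [v] is [|v|], attained at [(E v, v)]. Near the scale [m] the
    function [E] is linear of slope [ln m] up to an error [O(m)], so a ball of
    radius [m] is, up to constants, a parallelogram of height and horizontal
    width [m] leaning with slope [ln m]. The divergence of [ln m] as [m] tends
    to 0 drives both halves of the proof.

    Rows are mapped into rows ([row_const]). Suppose that the second coordinate
    of [F] differs at the two ends of a horizontal segment. Take [r] small and
    [L = - ln r]. Moving up by [r] and left by [r L] is a step of [D]-length
    exactly [r], so about [1 / (r L)] such steps join the two ends, and a thin
    strip along the segment contains about [1 / r] disjoint chains of this kind.
    By Cauchy-Schwarz the sum over all steps of the squared image lengths is at
    least of order [L], hence unbounded ([chains_energy]). On the other hand
    quasisymmetry puts around the image of each starting point a ball of radius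
    comparable to the image of the step, these balls are disjoint and stay in a
    bounded region, and an area count bounds the same sum independently of [r]
    ([energy_upper]).

    Hence [F (x, y) = (g x y, h y)], with [h] a monotone bijection of the line,
    increasing after composing with [p |-> - p]. Climbing from height [y] to [y
    + v] along [t_0 < ... < t_n], each time by such a shortest step, and coming
    back in one step displaces a point horizontally by [sum E (t_(i+1) - t_i) -
    E v], which is [- v] times the entropy of the partition. Quasisymmetry makes
    [F] respect such loops up to an error [O(h (y + v) - h y)] which does not
    depend on [n] ([loop]). With equal steps the displacement is [- v ln n], and
    its image does not depend on [x] up to that error; letting [v] tend to 0
    with [v ln n] fixed shows that [g x y] is affine in [x], of slope [a y]
    ([row_affine]). Entropy is at most [ln n], with equality for equal steps;
    comparing the loops with equal steps in the source and in the target as [n]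
    tends to infinity gives [h (y + v) - h y = a y * v] ([height_slope]). So [a]
    is a constant and [h] is affine, and comparing two rows along a single step
    shows that the remaining shear [c] is Lipschitz.

    Conversely such a map changes [u - E v] by the factor [a] up to a multiple
    of [|v|], so it is biLipschitz, and biLipschitz bijections are
    quasisymmetric with a linear control function. *)

(** * Quasimetrics *)

Section Quasimetrics.
Variables (R : realType) (A : Type) (d : quasimetric R A).

Lemma qdist_ge0 x y : 0 <= d x y.
Proof. by case: (qdistP d). Qed.

Lemma qdistC x y : d x y = d y x.
Proof. by case: (qdistP d). Qed.

Lemma qdist_eq0 x y : d x y = 0 <-> x = y.
Proof. by case: (qdistP d). Qed.

Lemma qdistxx x : d x x = 0.
Proof. exact/qdist_eq0. Qed.

Lemma qdist_gt0 x y : x <> y -> 0 < d x y.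
Proof.
move=> xy; rewrite lt_neqAle qdist_ge0 andbT eq_sym.
by apply/eqP => /qdist_eq0.
Qed.

End Quasimetrics.

(** * The quasimetric [D] *)

Section Geometry.
Variable R : realType.
Implicit Types (u v z : R) (p q : R * R).

Definition xlnx v : R := v * ln `|v|.

Lemma xlnx0 : xlnx 0 = 0. Proof. by rewrite /xlnx mul0r. Qed.

Lemma xlnxN v : xlnx (- v) = - xlnx v.
Proof. by rewrite /xlnx normrN mulNr. Qed.

Lemma xlnx_pos v : 0 < v -> xlnx v = v * ln v.
Proof. by move=> v0; rewrite /xlnx gtr0_norm. Qed.

(** The near-linearity of [xlnx] at the scale [m] which gives [D]-balls their
    parallelogram shape. *)
Lemma xlnx_approx m z : 0 < m -> `|z| <= 2 * m -> `|xlnx z - z * ln m| <= 2 * m.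
Proof. exact: xlnx_bound. Qed.

Lemma xlnxM a v : xlnx (a * v) = a * xlnx v + v * xlnx a.
Proof.
rewrite /xlnx normrM.
have [->|a0] := eqVneq a 0; first by rewrite !mul0r mulr0 addr0.
have [->|v0] := eqVneq v 0; first by rewrite !(mul0r, mulr0) addr0.
by rewrite lnM ?posrE ?normr_gt0//; ring.
Qed.

Lemma xlnx_small e : 0 < e ->
  exists2 t : R, 0 < t & forall z, `|z| <= t -> `|xlnx z| <= e.
Proof.
move=> e0; have [m m0 mE] : exists2 m, 0 < m & m = e / 4.
  by exists (e / 4) => //; lra.
have l0 : 0 < 1 + `|ln m| by have := normr_ge0 (ln m); lra.
exists (2 * m / (1 + `|ln m|)); first by apply: divr_gt0; lra.
move=> z; rewrite ler_pdivlMr// => zt.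
have z0 := normr_ge0 z.
have zl : 0 <= `|z| * `|ln m| by rewrite mulr_ge0.
have zm : `|z| <= 2 * m by move: zt; rewrite mulrDr mulr1; lra.
have := xlnx_approx m0 zm; have := ler_normD (xlnx z - z * ln m) (z * ln m).
rewrite subrK (normrM z (ln m)); move: zt; rewrite mulrDr mulr1; lra.
Qed.

Lemma xlnx_bounded A : exists B : R, forall z, `|z| <= A -> `|xlnx z| <= B.
Proof.
set m := `|A| + 1; have m0 : 0 < m by have := normr_ge0 A; rewrite /m; lra.
exists (2 * m + m * `|ln m|) => z zA.
have zm : `|z| <= m by have := ler_norm A; rewrite /m; lra.
have zm2 : `|z| <= 2 * m by lra.
have := xlnx_approx m0 zm2; have := ler_normD (xlnx z - z * ln m) (z * ln m).
rewrite subrK (normrM z (ln m)) => h1 h2.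
have : `|z| * `|ln m| <= m * `|ln m| by rewrite ler_wpM2r.
by lra.
Qed.

Lemma D_le p q r : (D R p q <= r) =
  (`|q.2 - p.2| <= r) && (`|(q.1 - p.1) - xlnx (q.2 - p.2)| <= r).
Proof. by rewrite /= /D_fun ge_max. Qed.

Lemma D_ge2 p q : `|q.2 - p.2| <= D R p q.
Proof. by have := D_le p q (D R p q); rewrite lexx => /esym/andP[]. Qed.

Lemma D_ge1 p q : `|(q.1 - p.1) - xlnx (q.2 - p.2)| <= D R p q.
Proof. by have := D_le p q (D R p q); rewrite lexx => /esym/andP[]. Qed.

Lemma D_row x x' y : D R (x, y) (x', y) = `|x' - x|.
Proof.
by rewrite /= /D_fun /= subrr mul0r subr0 normr0; apply/max_idPr.
Qed.

(** This lemma and the next two compare [D] with the Euclidean distance: same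
    small sets and same bounded sets, although the two are not
    Lipschitz-equivalent. *)
Lemma D_near e : 0 < e -> exists2 t : R, 0 < t & forall p q,
  `|q.1 - p.1| <= t -> `|q.2 - p.2| <= t -> D R p q <= e.
Proof.
move=> e0; have e2 : 0 < e / 2 by lra.
have [t t0 ht] := xlnx_small e2.
have m1 : Num.min t (e / 2) <= t by rewrite ge_min lexx.
have m2 : Num.min t (e / 2) <= e / 2 by rewrite ge_min lexx orbT.
exists (Num.min t (e / 2)); first by rewrite lt_min t0.
move=> p q h1 h2; rewrite D_le; apply/andP; split; first lra.
have h3 := ht _ (le_trans h2 m1).
have := ler_normB (q.1 - p.1) (xlnx (q.2 - p.2)); lra.
Qed.

Lemma D_bounded A : exists B : R, forall p q,
  `|q.1 - p.1| <= A -> `|q.2 - p.2| <= A -> D R p q <= B.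
Proof.
have [B hB] := xlnx_bounded A; exists (A + `|B|) => p q h1 h2.
have b0 := normr_ge0 B; have bB := ler_norm B.
rewrite D_le; apply/andP; split; first lra.
have h3 := hB _ h2.
have := ler_normB (q.1 - p.1) (xlnx (q.2 - p.2)); lra.
Qed.

Lemma bounded_D A : exists2 B : R, 0 <= B & forall p q, D R p q <= A ->
  `|q.1 - p.1| <= B /\ `|q.2 - p.2| <= B.
Proof.
have [B hB] := xlnx_bounded A; exists (`|A| + `|B|).
  by rewrite addr_ge0.
move=> p q; rewrite D_le => /andP[h1 h2].
have b0 := normr_ge0 B; have bB := ler_norm B.
have a0 := normr_ge0 A; have aA := ler_norm A.
split; last lra.
have h3 := hB _ h1.
have := ler_normD (q.1 - p.1 - xlnx (q.2 - p.2)) (xlnx (q.2 - p.2)).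
rewrite subrK; lra.
Qed.

End Geometry.

(** * Packing of balls *)
Section Packing.
Variable R : realType.

(** Integrate the step function [sum_i w_i 1_[a_i, b_i]] over [[A, B]]. *)
Lemma weighted_intervals (I : finType) (w a b : I -> R) (A B W : R) :
  A <= B -> (forall i, 0 <= w i) ->
  (forall i, [/\ A <= a i, a i <= b i & b i <= B]) ->
  (forall t, \sum_(i | a i <= t <= b i) w i <= W) ->
  \sum_i w i * (b i - a i) <= W * (B - A).
Proof.
move=> AB w0 hab hW.
pose mu := @lebesgue_measure R.
have mI i : measurable (`[a i, b i]%classic : set (measurableTypeR R)) by [].
have mlen (x y : R) : x <= y -> mu `[x, y]%classic = (y - x)%:E.
  move=> xy; rewrite /mu lebesgue_measure_itv /= lte_fin.
  by case: ltgtP xy => // -> _; rewrite subrr.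
have W0 : 0 <= W by apply: le_trans (hW A); apply: sumr_ge0.
rewrite -lee_fin -sumEFin.
pose f i t : \bar R := ((w i)%:E * (\1_(`[a i, b i]%classic) t)%:E)%E.
have fE i : (\int[mu]_(t in `[A, B]) f i t = (w i * (b i - a i))%:E)%E.
  rewrite ge0_integralZl_EFin//.
  - rewrite integral_indic// setIidl.
      by rewrite EFinM; congr (_ * _)%E; apply: mlen; have [] := hab i.
    have [h1 _ h2] := hab i.
    by apply: subset_itv; rewrite bnd_simp.
  - by apply/measurable_EFinP; apply: measurable_funTS; exact: measurable_indic.
have mf i : measurable_fun `[A, B]%classic (f i).
  apply: measurable_funeM; apply/measurable_EFinP.
  by apply: measurable_funTS; exact: measurable_indic.
have f0 i t : (0 <= f i t)%E by rewrite mule_ge0// lee_fin.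
have -> : (\sum_i (w i * (b i - a i))%:E =
    \int[mu]_(t in `[A, B]) (\sum_i f i t))%E.
  rewrite ge0_integral_sum//.
  by apply: eq_bigr => i _; rewrite fE.
have -> : ((W * (B - A))%:E = \int[mu]_(t in `[A, B]) (W%:E))%E.
  by rewrite integral_cst// EFinM; congr (_ * _)%E; apply/esym/mlen.
apply: ge0_le_integral => //.
- by move=> t _; apply: sume_ge0 => i _; exact: f0.
- by apply: emeasurable_sum => i; exact: mf.
- move=> t _; rewrite /f sumEFin lee_fin.
  apply: le_trans (hW t); rewrite [leRHS]big_mkcond; apply: ler_sum => i _.
  rewrite indicE; case: ifPn => [h|h].
    by rewrite mem_set ?mulr1.
  by rewrite memNset ?mulr0//= in_itv; exact/negP.
Qed.
Lemma parallelogram_sub_ball (c z : R * R) (m : R) : 0 < m ->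
  `|z.2 - c.2| <= m -> `|z.1 - c.1 - (z.2 - c.2) * ln m| <= m ->
  D R c z <= 3 * m.
Proof.
move=> m0 h2 h1; rewrite D_le; apply/andP; split; first lra.
have h3 : `|z.2 - c.2| <= 2 * m by lra.
have := xlnx_approx m0 h3.
have := ler_normB (z.1 - c.1 - (z.2 - c.2) * ln m)
  (xlnx (z.2 - c.2) - (z.2 - c.2) * ln m).
rewrite opprB addrA subrK; lra.
Qed.

(** Disjoint balls in a bounded region have bounded total squared radius,
    since each contains a parallelogram of comparable area.  The area count is
    done by slicing: at each height the horizontal sections are disjoint
    intervals, which bounds the total width of the parallelograms met there,
    and this bound is then integrated over the heights. *)
Lemma ball_packing (I : finType) (c : I -> R * R) (m : I -> R)
    (p : R * R) (A : R) :
  0 <= A -> (forall i, 0 < m i) ->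
  (forall i j z, D R (c i) z <= 3 * m i -> D R (c j) z <= 3 * m j -> i = j) ->
  (forall i z, D R (c i) z <= 3 * m i ->
     `|z.1 - p.1| <= A /\ `|z.2 - p.2| <= A) ->
  \sum_i (2 * m i) ^+ 2 <= (2 * A) ^+ 2.
Proof.
move=> A0 m0 disj box.
pose para i (x y : R) := D R (c i) (x, y) <= 3 * m i.
have inpara i (x y : R) : (c i).2 - m i <= y <= (c i).2 + m i ->
    (c i).1 + (y - (c i).2) * ln (m i) - m i <= x <=
    (c i).1 + (y - (c i).2) * ln (m i) + m i -> para i x y.
  move=> hy hx; apply: parallelogram_sub_ball => //=.
    by rewrite ler_norml; lra.
  by rewrite ler_norml; lra.
have -> : \sum_i (2 * m i) ^+ 2 =
    \sum_i (2 * m i) * (((c i).2 + m i) - ((c i).2 - m i)).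
  by apply: eq_bigr => i _; ring.
have -> : (2 * A) ^+ 2 = (2 * A) * ((p.2 + A) - (p.2 - A)) by ring.
apply: weighted_intervals.
- lra.
- by move=> i; have := m0 i; lra.
- move=> i; have mi := m0 i; split; last 1 first.
  + have /box[_ /=] : para i ((c i).1 + m i * ln (m i)) ((c i).2 + m i).
      by apply: inpara; lra.
    by rewrite ler_norml; lra.
  + have /box[_ /=] : para i ((c i).1 - m i * ln (m i)) ((c i).2 - m i).
      by apply: inpara; lra.
    by rewrite ler_norml; lra.
  + lra.
move=> y.
pose P i := (c i).2 - m i <= y <= (c i).2 + m i.
pose a i := if P i then (c i).1 + (y - (c i).2) * ln (m i) - m i else p.1 - A.
pose b i := if P i then (c i).1 + (y - (c i).2) * ln (m i) + m i else p.1 - A.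
have -> : \sum_(i | P i) 2 * m i = \sum_i (P i)%:R * (b i - a i).
  rewrite big_mkcond; apply: eq_bigr => i _; rewrite /a /b.
  by case: ifP => _; rewrite ?mul1r ?mul0r; ring.
have -> : 2 * A = 1 * ((p.1 + A) - (p.1 - A)) by ring.
apply: weighted_intervals.
- lra.
- by move=> i; rewrite ler0n.
- move=> i; have mi := m0 i; rewrite /a /b; case: ifPn => [Pi|_]; last first.
    by split; lra.
  set e := (c i).1 + _.
  have /box[/= + _] : para i (e - m i) y.
    by apply: inpara => //; rewrite -/e; lra.
  have /box[/= + _] : para i (e + m i) y.
    by apply: inpara => //; rewrite -/e; lra.
  by rewrite !ler_norml; split; lra.
move=> x; have [[i0 /andP[Pi0 xi0]]|no] :=
  pselect (exists i, P i && (a i <= x <= b i)).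
  rewrite (bigD1 i0)//= Pi0 big1 ?addr0// => i /andP[xi ii0].
  case Pi : (P i) => //; exfalso; move/eqP: ii0; apply.
  move: xi xi0; rewrite /a /b Pi Pi0 => xi xi0.
  by apply: (disj _ _ (x, y)); [exact: inpara|exact: inpara].
rewrite big1// => i xi; case Pi : (P i) => //; exfalso.
by apply: no; exists i; rewrite Pi.
Qed.

End Packing.

(** * A symmetric form of quasisymmetry *)

Section WeakQS.
Variable R : realType.

(** A continuous injection of an interval is strictly monotone, and a decreasing
    one could not be onto the half-line. *)
Lemma homeo_nonneg_mono (eta : R -> R) :
  homeomorphism_on (@nonneg_reals R) (@nonneg_reals R) eta ->
  eta 0 = 0 /\ forall s t, 0 <= s -> s < t -> eta s < eta t.
Proof.
move=> [g [fAB gBA [fg gf] cf cg]].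
have E : @nonneg_reals R = [set` `[0, +oo[].
  by apply/seteqP; split=> t; rewrite /nonneg_reals /= in_itv /= andbT.
have etag s : 0 <= s -> eta (g s) = s by move=> s0; apply: gf; rewrite inE.
have g0 s : 0 <= s -> 0 <= g s by exact: gBA.
have eta0 s : 0 <= s -> 0 <= eta s by exact: fAB.
have inj : {in `[0, +oo[ &, injective eta}.
  move=> x y; rewrite !in_itv /= !andbT => x0 y0 exy.
  have gx : g (eta x) = x by apply: fg; rewrite inE.
  have gy : g (eta y) = y by apply: fg; rewrite inE.
  by rewrite -gx exy gy.
have := @itv_continuous_inj_mono _ eta `[0, +oo[.
rewrite -E => /(_ cf inj)[] mono.
- have mono' s t : 0 <= s -> s < t -> eta s < eta t.
    move=> s0 st; apply: mono => //; rewrite in_itv /= andbT//.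
    exact: le_trans s0 (ltW st).
  split=> //; apply/eqP; rewrite eq_le eta0// andbT.
  have := g0 _ (lexx 0); rewrite [0 <= g 0]le_eqVlt => /predU1P[g00|gp].
    by rewrite {1}g00 etag.
  by have := mono' _ _ (lexx 0) gp; rewrite etag// => /ltW.
- have e0 := eta0 _ (lexx 0).
  have e1 : 0 <= eta 0 + 1 by lra.
  have := g0 _ e1; rewrite [0 <= g _]le_eqVlt => /predU1P[g00|gp].
    by have := etag _ e1; rewrite -g00; lra.
  have : eta (g (eta 0 + 1)) < eta 0.
    by apply: (mono _ _ _ _ gp); rewrite in_itv /= andbT// ltW.
  by rewrite etag//; lra.
Qed.

(** The two consequences of quasisymmetry that the proof uses: comparable
    distances stay comparable, and relatively small distances stay relatively
    small.  They make sense for degenerate triples as well, and each of the two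
    clauses is the contrapositive of the other one for the inverse map, so the
    notion passes to inverses without inverting the control function. *)
Definition weak_qs (X Y : Type) (dX : quasimetric R X) (dY : quasimetric R Y)
    (F : X -> Y) : Prop :=
  (forall K, exists2 C : R, 0 < C & forall p q z,
     dX p q <= K * dX p z -> dY (F p) (F q) <= C * dY (F p) (F z)) /\
  (forall e, 0 < e -> exists2 d : R, 0 < d & forall p q z,
     dX p q <= d * dX p z -> dY (F p) (F q) <= e * dY (F p) (F z)).

Section Generic.
Variables (X Y : Type) (dX : quasimetric R X) (dY : quasimetric R Y).

Lemma quasisymmetric_weak (F : X -> Y) :
  quasisymmetric dX dY F -> weak_qs dX dY F.
Proof.
move=> [eta [/[dup] het /homeo_nonneg_mono[eta0 mono] [bF qs]]].
have mono' s t : 0 <= s -> s <= t -> eta s <= eta t.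
  move=> s0; rewrite le_eqVlt => /predU1P[->//|st].
  by apply/ltW/mono.
have etage t : 0 <= t -> 0 <= eta t by move=> t0; rewrite -eta0 mono'.
have key k C : 0 <= k -> 0 < C -> eta k <= C -> (1 <= C \/ k < 1) ->
    forall p q z, dX p q <= k * dX p z -> dY (F p) (F q) <= C * dY (F p) (F z).
  move=> k0 C0 eC C1 p q z h.
  have [<-|pq] := pselect (p = q).
    rewrite (qdist_eq0 dY _ _).2// mulr_ge0 ?qdist_ge0//; exact: ltW.
  have dpq := qdist_gt0 dX pq.
  have pz : p <> z.
    by move=> pz; move: h; rewrite (qdist_eq0 dX p z).2// mulr0; lra.
  have dpz := qdist_gt0 dX pz.
  have [qz|qz] := pselect (q = z).
    subst z; case: C1 => [C1|k1].
      by rewrite ler_peMl ?qdist_ge0.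
    have : k * dX p q < 1 * dX p q by rewrite ltr_pM2r.
    by lra.
  have Fpz : F p <> F z by move=> /(bij_inj bF).
  have dF := qdist_gt0 dY Fpz.
  have := qs p q z pq qz pz; rewrite ler_pdivrMr// => /le_trans; apply.
  rewrite ler_pM2r//; apply: le_trans eC; apply: mono'.
    by rewrite divr_ge0 ?qdist_ge0.
  by rewrite ler_pdivrMr.
split=> [K|e e0].
  have K0 := normr_ge0 K; have e0 := etage _ K0.
  exists (eta `|K| + 1); first lra.
  move=> p q z h; apply: (key `|K|) => //.
  - lra.
  - lra.
  - left; lra.
  - by apply: le_trans h _; rewrite ler_wpM2r ?qdist_ge0// ler_norm.
have [g [fAB gBA [fg gf] cf cg]] := het.
have etag s : 0 <= s -> eta (g s) = s by move=> s0; apply: gf; rewrite inE.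
have ge0 : 0 <= g e by apply: gBA; exact: ltW.
have gp : 0 < g e.
  rewrite lt_neqAle ge0 andbT; apply/eqP => g0.
  by have := etag e (ltW e0); rewrite -g0 eta0; lra.
(* A factor below 1 settles the triples with [q = z]. *)
have m1 : Num.min (g e) (1 / 2) <= g e by rewrite ge_min lexx.
have m2 : Num.min (g e) (1 / 2) <= 1 / 2 by rewrite ge_min lexx orbT.
have m0 : 0 < Num.min (g e) (1 / 2) by rewrite lt_min gp /=; lra.
exists (Num.min (g e) (1 / 2)) => //.
move=> p q z h.
apply: (key (Num.min (g e) (1 / 2))) => //.
- exact: ltW.
- rewrite -[leRHS]etag; last exact: ltW.
  by apply: mono' => //; exact: ltW.
- by right; lra.
Qed.

(** Up to degenerate triples, each clause for [G] is the contrapositive of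
    the other clause for [F]. *)
Lemma weak_qs_inv (F : X -> Y) (G : Y -> X) : cancel F G -> cancel G F ->
  weak_qs dX dY F -> weak_qs dY dX G.
Proof.
move=> FG GF [qs1 qs2]; have eq0 k p q : dY p q <= k * dY p p -> dY p q = 0.
  rewrite (qdist_eq0 dY p p).2// mulr0 => h.
  by apply/eqP; rewrite eq_le h qdist_ge0.
split=> [K|e e0].
  have K0 := normr_ge0 K.
  have e0 : 0 < (`|K| + 1)^-1 by rewrite invr_gt0; lra.
  have [d d0 hd] := qs2 _ e0.
  exists d^-1; first by rewrite invr_gt0.
  move=> p q z h; rewrite leNgt; apply/negP => hlt.
  have /hd : dX (G p) (G z) <= d * dX (G p) (G q).
    by rewrite -ler_pdivrMl// ltW.
  rewrite !GF ler_pdivlMl; last lra.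
  rewrite mulrDl mul1r => h2.
  have h3 : K * dY p z <= `|K| * dY p z.
    by rewrite ler_wpM2r ?qdist_ge0// ler_norm.
  have pz0 := qdist_ge0 dY p z.
  have /qdist_eq0 pz : dY p z = 0 by lra.
  move: h hlt; rewrite -pz => /eq0/qdist_eq0 <-.
  by rewrite (qdist_eq0 dX _ _).2// mulr0 ltxx.
have [C C0 hC] := qs1 (e^-1).
exists (C + 1)^-1; first by rewrite invr_gt0; lra.
move=> p q z h; rewrite leNgt; apply/negP => hlt.
have /hC : dX (G p) (G z) <= e^-1 * dX (G p) (G q).
  by rewrite ler_pdivlMl// ltW.
rewrite !GF => h2.
move: h; rewrite ler_pdivlMl; last lra.
rewrite mulrDl mul1r => h.
have pq0 := qdist_ge0 dY p q.
have /qdist_eq0 pq : dY p q = 0 by lra.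
move: hlt; rewrite -pq (qdist_eq0 dX (G p) (G p)).2// => hlt.
have : 0 <= e * dX (G p) (G z) by rewrite mulr_ge0 ?qdist_ge0// ltW.
by rewrite leNgt hlt.
Qed.
End Generic.
End WeakQS.

(** * Horizontal lines are preserved *)

Section Horizontal.
Variable R : realType.

(** Cauchy-Schwarz, in the form [rho ^ 2 >= 2 t rho - t ^ 2], [t = s / n]. *)
Lemma energy_lower (n : nat) (s : R) (rho : 'I_n -> R) : (0 < n)%N ->
  s <= \sum_i rho i -> 0 <= s -> s ^+ 2 <= n%:R * \sum_i rho i ^+ 2.
Proof.
move=> n0 hs s0.
have np : 0 < n%:R :> R by rewrite ltr0n.
have [t tE] : exists t, n%:R * t = s.
  by exists (s / n%:R); rewrite mulrC divfK ?gt_eqF.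
have t0 : 0 <= t by rewrite -(pmulr_rge0 _ np) tE.
have : \sum_i (2 * t * rho i - t ^+ 2) <= \sum_i rho i ^+ 2.
  apply: ler_sum => i _; rewrite -subr_ge0.
  have -> : rho i ^+ 2 - (2 * t * rho i - t ^+ 2) = (rho i - t) ^+ 2 by ring.
  exact: sqr_ge0.
rewrite sumrB -mulr_sumr sumr_const card_ord -[X in _ - X]mulr_natl => h.
have h2 : n%:R * (2 * t * s - n%:R * t ^+ 2) <= n%:R * \sum_i rho i ^+ 2.
  rewrite ler_pM2l//; apply: le_trans h; rewrite lerD2r.
  by rewrite ler_wpM2l// mulr_ge0.
apply: le_trans h2; rewrite -tE le_eqVlt; apply/orP; left; apply/eqP; ring.
Qed.

Variables (F G : R * R -> R * R).
Hypotheses (FG : cancel F G) (GF : cancel G F).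
Hypothesis qsF : weak_qs (D R) (D R) F.

Lemma weak_qs_continuous p e : 0 < e -> exists2 t : R, 0 < t & forall z,
  `|z.1 - p.1| <= t -> `|z.2 - p.2| <= t -> D R (F p) (F z) <= e.
Proof.
move=> e0; set q := (p.1 + 1, p.2).
have Dpq : D R p q = 1.
  by rewrite /q [p in D R p]surjective_pairing D_row addrC addKr normr1.
set a := D R (F p) (F q); have a0 : 0 <= a by exact: qdist_ge0.
have [d d0 hd] := qsF.2 (e / (a + 1)) ltac:(apply: divr_gt0; lra).
have [t t0 ht] := D_near d0.
exists t => // z z1 z2; have : D R p z <= d * D R p q.
  by rewrite Dpq mulr1; exact: ht.
move=> /hd/le_trans; apply; rewrite -/a.
by rewrite mulrAC ler_pdivrMr; [nra|lra].
Qed.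

(** If an [r]-separated family of points [c i] comes with points [c' i] at
    distance [r], then by quasisymmetry of the inverse the balls around
    [F (c i)] of radius a small fixed multiple of [D (F (c i)) (F (c' i))] are
    images of sets contained in the disjoint balls of radius [r / (3 M)]
    around the [c i]; the packing bound applies to them. *)
Lemma energy_upper (p : R * R) (A : R) : exists C : R,
  forall (I : finType) (c c' : I -> R * R) (r : R),
  0 < r -> r <= 2 ->
  (forall i j, i != j -> r <= D R (c i) (c j)) ->
  (forall i, D R (c i) (c' i) = r) ->
  (forall i, `|(c i).1 - p.1| <= A /\ `|(c i).2 - p.2| <= A) ->
  \sum_i D R (F (c i)) (F (c' i)) ^+ 2 <= C.
Proof.
have [_ _ _ [M M1 tri]] := qdistP (D R).
have M0 : 0 < M by lra.
(* With this ratio, a point lying in two of the balls around the [c i] would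
   bring their centres closer than [2 r / 3]. *)
have [d d0 hd] := (weak_qs_inv FG GF qsF).2 (1 / (3 * M))
  ltac:(apply: divr_gt0; lra).
have [B hB] := D_bounded A.
set q := (p.1 + 1, p.2).
have Dpq : D R p q = 1.
  by rewrite /q [p in D R p]surjective_pairing D_row addrC addKr normr1.
have [C1 _ hC1] := qsF.1 (M * (B + 1)).
have [A' A'0 hA'] := bounded_D (C1 * D R (F p) (F q)).
exists ((2 * A') ^+ 2 / (2 * (d / 3)) ^+ 2).
move=> I c c' r r0 r1 sep step box.
pose m i := d / 3 * D R (F (c i)) (F (c' i)).
have rho0 i : 0 < D R (F (c i)) (F (c' i)).
  apply: qdist_gt0 => /(can_inj FG) e.
  by have := step i; rewrite e qdistxx => r00; move: r0; rewrite -r00 ltxx.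
have near i z : D R (F (c i)) z <= 3 * m i -> D R (c i) (G z) <= r / (3 * M).
  have -> : 3 * m i = d * D R (F (c i)) (F (c' i)) by rewrite /m; field.
  by move=> /hd; rewrite !FG step => /le_trans; apply; rewrite mul1r mulrC.
have rM : r / (3 * M) <= 1.
  by rewrite ler_pdivrMr; nra.
have rM3 : M * (r / (3 * M)) = r / 3 by field; lra.
have : \sum_i (2 * m i) ^+ 2 <= (2 * A') ^+ 2.
  apply: (@ball_packing R I (F \o c) m (F p) A') => //=.
  - by move=> i; rewrite /m mulr_gt0//; lra.
  - move=> i j z /near hi /near hj; apply/eqP; apply/negPn/negP => /sep.
    have := tri (c i) (G z) (c j); rewrite (qdistC (D R) (G z) (c j)) => h h'.
    have : M * (D R (c i) (G z) + D R (c j) (G z)) <=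
       r / 3 + r / 3 by rewrite -rM3 -mulrDr ler_wpM2l//; lra.
    by lra.
  - move=> i z /near hi; apply: hA'.
    have [b1 b2] := box i; have hb := hB p (c i) b1 b2.
    have : D R p (G z) <= (M * (B + 1)) * D R p q.
      rewrite Dpq mulr1; apply: (le_trans (tri p (c i) (G z))).
      by rewrite ler_wpM2l//; lra.
    by move=> /hC1; rewrite GF.
rewrite ler_pdivlMr; last by apply: exprn_gt0; lra.
apply: le_trans; rewrite mulr_suml le_eqVlt; apply/orP; left; apply/eqP.
by apply: eq_bigr => i _; rewrite /m; ring.
Qed.

Lemma expRN_bound (L : R) : 0 <= L -> expR (- L) * L ^+ 2 <= 2.
Proof.
move=> L0; have h := @expR_ge1Dxn R L 1 L0.
rewrite expRN mulrC ler_pdivrMr ?expR_gt0//.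
have f2 : 2`!%:R = 2 :> R by [].
by rewrite f2 in h; lra.
Qed.

Section Grid.
Variables (x0 y0 r L : R).
(** A grid of mesh [r L] horizontally and [r] vertically, with [L = - ln r]: the
    anti-diagonal neighbours are then at [D]-distance exactly [r]. *)
Definition grid_point (i j : nat) : R * R :=
  (x0 + i%:R * (r * L), y0 + j%:R * r).

Lemma grid_step i j : 0 < r -> L = - ln r ->
  D R (grid_point i.+1 j) (grid_point i j.+1) = r.
Proof.
move=> r0 LE; rewrite /= /D_fun /=.
have -> : y0 + j.+1%:R * r - (y0 + j%:R * r) = r by rewrite -natr1; ring.
have -> : x0 + i%:R * (r * L) - (x0 + i.+1%:R * (r * L)) - r * ln `|r| = 0.
  by rewrite -natr1 LE gtr0_norm//; ring.
by rewrite normr0 gtr0_norm//; apply/max_idPl; exact: ltW.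
Qed.

Lemma grid_separated i j i' j' : 0 < r -> 1 <= L -> (i, j) != (i', j') ->
  r <= D R (grid_point i j) (grid_point i' j').
Proof.
move=> r0 L1 ne.
have dist (a b : nat) : a != b -> 1 <= `|b%:R - a%:R| :> R.
  case: ltngtP => // ab _; last rewrite distrC.
    by rewrite -natrB ?(ltnW ab)// normr_nat ler1n subn_gt0.
  by rewrite -natrB ?(ltnW ab)// normr_nat ler1n subn_gt0.
have [jj|jj] := eqVneq j j'.
  have ii : i != i' by apply: contra ne => /eqP->; rewrite jj.
  rewrite jj D_row opprD addrACA subrr add0r -mulrBl normrM.
  have -> : `|r * L| = r * L by rewrite ger0_norm// mulr_ge0//; lra.
  rewrite -[leLHS]mul1r ler_pM//; [lra|exact: dist|by rewrite ler_peMr// ltW].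
apply: le_trans (D_ge2 _ _) => /=.
rewrite opprD addrACA subrr add0r -mulrBl normrM (gtr0_norm r0).
by rewrite -[leLHS]mul1r ler_pM2r// dist.
Qed.
End Grid.

Lemma nat_ceil (x s : R) : 0 <= x -> 0 < s ->
  exists2 n, (0 < n)%N & x < n%:R * s <= x + s.
Proof.
move=> x0 s0; exists (Num.truncn (x / s)).+1 => //.
have /truncn_itv/andP[h1 h2] : 0 <= x / s by rewrite divr_ge0// ltW.
rewrite -ltr_pdivrMr// h2 /= -natr1 mulrDl mul1r lerD2r.
by rewrite -ler_pdivlMr.
Qed.

(** The numerical requirements on [L] in the chain argument, collected here so
    that the last one contradicts [chains_energy] for the upper bound [C]. *)
Lemma choose_scale (l t d C : R) : 0 < l -> 0 < t -> 0 < d -> 0 <= C ->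
  exists L : R, [/\ 1 <= L, 8 <= L * t, 2 <= L * l, 4 * l <= L * t &
    8 * C * l < L * (t * d ^+ 2)].
Proof.
move=> l0 t0 d0 C0.
have td0 : 0 < t * d ^+ 2 by rewrite mulr_gt0// exprn_gt0.
have a1 : 0 <= 8 / t by rewrite divr_ge0// ltW.
have a2 : 0 <= 2 / l by rewrite divr_ge0// ltW.
have a3 : 0 <= 4 * l / t by rewrite divr_ge0// ?mulr_ge0// ltW.
have a4 : 0 <= 8 * C * l / (t * d ^+ 2).
  by rewrite divr_ge0// ?mulr_ge0// ltW.
exists (1 + 8 / t + 2 / l + 4 * l / t + 8 * C * l / (t * d ^+ 2)).
rewrite -!ler_pdivrMr// -ltr_pdivrMr//.
move: a1 a2 a3 a4; move: (8 / t) (2 / l) (4 * l / t) (_ / _) => a b c e.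
by split; lra.
Qed.

Lemma choose_radius (L : R) : 1 <= L ->
  exists r : R, [/\ 0 < r, r * L ^+ 2 <= 2 & L = - ln r].
Proof.
move=> L1; exists (expR (- L)); rewrite expR_gt0 expRK opprK; split => //.
by apply: expRN_bound; lra.
Qed.

Lemma mesh_bounds (r L l t : R) : 0 < r -> 1 <= L -> r * L ^+ 2 <= 2 ->
  8 <= L * t -> 2 <= L * l ->
  [/\ r <= 2, r * L <= t, r * L <= l & 4 * r <= t].
Proof.
move=> r0 L1 rL Lt Ll; have L0 : 0 < L by lra.
have sL : r * L * L <= 2 by rewrite -mulrA -expr2.
have rrL : r <= r * L by rewrite ler_peMr// ltW.
have rLL : r * L <= r * L * L by rewrite ler_peMr// ltW// mulr_gt0.
by split; first lra; rewrite -(ler_pM2r L0); lra.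
Qed.

(** The segment from [(x0, y0)] to [(x0 + l, y0)] and its [t]-neighbourhood are
    fixed.  The chain number [b < B] runs along the anti-diagonals of the grid
    from near the right end to near the left end in [M] steps. *)
Section Chains.
Variables (x0 y0 l t r L : R) (B M : nat).
Hypotheses (l0 : 0 < l) (t0 : 0 < t) (r0 : 0 < r) (L1 : 1 <= L).
Hypothesis LE : L = - ln r.
Hypotheses (Ms : l < M%:R * (r * L) <= l + t) (BM : (B + M)%:R * r <= t).

Definition chain (b k : nat) := grid_point x0 y0 r L (M - k) (b + k).

Lemma chain_step b k : (k < M)%N -> D R (chain b k) (chain b k.+1) = r.
Proof.
by move=> kM; rewrite /chain -(subnSK kM) addnS; exact: grid_step.
Qed.

Lemma chain_separated (b b' : 'I_B) (k k' : 'I_M) : (b, k) != (b', k') ->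
  r <= D R (chain b k) (chain b' k').
Proof.
move=> bk; apply: grid_separated => //.
apply: contra bk => /eqP[e1 e2].
have kM := ltn_ord k; have kM' := ltn_ord k'.
have kk : k = k' :> nat by clear -kM kM' e1 e2; lia.
have bb : b = b' :> nat by clear -kk e2; lia.
by rewrite xpair_eqE; apply/andP; split; apply/eqP/val_inj.
Qed.

Lemma chain_box b k : (b < B)%N -> (k <= M)%N ->
  0 <= (chain b k).1 - x0 <= l + t /\ 0 <= (chain b k).2 - y0 <= t.
Proof.
move=> bB kM; rewrite /chain /grid_point /= (addrC x0) (addrC y0) !addrK.
case/andP: Ms => _ Mu.
have s0 : 0 < r * L by rewrite mulr_gt0// (lt_le_trans _ L1).
split; apply/andP; split.
- by rewrite mulr_ge0// ltW.
- by apply: le_trans Mu; rewrite ler_pM2r// ler_nat leq_subr.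
- by rewrite mulr_ge0// ltW.
- by apply: le_trans BM; rewrite ler_pM2r// ler_nat leq_add// ltnW.
Qed.

Lemma chain_start b : (b < B)%N ->
  `|(chain b 0).1 - (x0 + l)| <= t /\ `|(chain b 0).2 - y0| <= t.
Proof.
move=> bB; have [_ /andP[h1 h2]] := chain_box bB (leq0n M).
split; last by rewrite ger0_norm.
rewrite /chain /grid_point /= subn0 opprD addrACA subrr add0r ger0_norm.
  by rewrite lerBlDl; case/andP: Ms.
by rewrite subr_ge0; case/andP: Ms => /ltW.
Qed.

Lemma chain_end b : (b < B)%N ->
  `|(chain b M).1 - x0| <= t /\ `|(chain b M).2 - y0| <= t.
Proof.
move=> bB; have [_ /andP[h1 h2]] := chain_box bB (leqnn M).
split; last by rewrite ger0_norm.
by rewrite /chain /= subnn mul0r addr0 subrr normr0 ltW.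
Qed.

Lemma chain_energy (b : nat) (d : R) : (b < B)%N -> 0 < d ->
  (forall z, `|z.1 - x0| <= t -> `|z.2 - y0| <= t ->
     D R (F (x0, y0)) (F z) <= d) ->
  (forall z, `|z.1 - (x0 + l)| <= t -> `|z.2 - y0| <= t ->
     D R (F (x0 + l, y0)) (F z) <= d) ->
  4 * d = `|(F (x0 + l, y0)).2 - (F (x0, y0)).2| ->
  (2 * d) ^+ 2 <=
    M%:R * \sum_(k < M) D R (F (chain b k)) (F (chain b k.+1)) ^+ 2.
Proof.
move=> bB d0 near0 near1.
have [u1 u2] := chain_start bB; have [v1 v2] := chain_end bB.
have e1 := le_trans (D_ge2 _ _) (near1 _ u1 u2).
have e2 := le_trans (D_ge2 _ _) (near0 _ v1 v2).
have M0 : (0 < M)%N.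
  by case: (M) Ms => //; rewrite mul0r => /andP[/(lt_trans l0)]; rewrite ltxx.
have := @telescope_sumr _ 0 M (fun k => (F (chain b k)).2) isT.
rewrite big_mkord => tel h.
apply: energy_lower => //; last by rewrite mulr_ge0// ltW.
have : `|(F (chain b M)).2 - (F (chain b 0)).2| <=
    \sum_(k < M) D R (F (chain b k)) (F (chain b k.+1)).
  rewrite -tel; apply: le_trans (ler_norm_sum _ _ _) _.
  by apply: ler_sum => k _; exact: D_ge2.
move: e1 e2 h; move: (\sum_(k < M) _) => S.
rewrite !ler_norml.
move: (F (chain b 0)).2 (F (chain b M)).2 (F (x0 + l, y0)).2 (F (x0, y0)).2.
move=> a c e f /andP[? ?] /andP[? ?] h /andP[? ?].
by move: h; case: (ger0P (e - f)) => ? ?; lra.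
Qed.

(** The sum of the lower bounds of the [B] chains.  As [B r] is of order [t] and
    [M r L] of order [l], the total energy is of order [L t d ^ 2 / l]. *)
Lemma chains_energy (C d : R) : 0 < d ->
  t <= 4 * r * B%:R -> M%:R * (r * L) <= 2 * l ->
  (forall b, (b < B)%N -> (2 * d) ^+ 2 <=
    M%:R * \sum_(k < M) D R (F (chain b k)) (F (chain b k.+1)) ^+ 2) ->
  \sum_(i : 'I_B * 'I_M)
    D R (F (chain i.1 i.2)) (F (chain i.1 i.2.+1)) ^+ 2 <= C ->
  L * (t * d ^+ 2) <= 2 * C * l.
Proof.
move=> d0 Bl Mu low up.
have tot : B%:R * (2 * d) ^+ 2 <= M%:R * C.
  apply: (le_trans _ (ler_wpM2l (ler0n _ M) up)).
  rewrite -(pair_bigA _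
    (fun (b : 'I_B) (k : 'I_M) =>
       D R (F (chain b k)) (F (chain b k.+1)) ^+ 2)) /= mulr_sumr.
  rewrite -[X in X%:R * _]card_ord mulr_natl -sumr_const.
  by apply: ler_sum => b _; exact: low.
have L0 : 0 <= L by apply: le_trans L1.
have d2 : 0 <= d ^+ 2 by rewrite exprn_ge0// ltW.
have C0 : 0 <= C.
  by apply: le_trans up; apply: sumr_ge0 => i _; apply: sqr_ge0.
apply: (@le_trans _ _ (L * (4 * r * B%:R * d ^+ 2))).
  by rewrite ler_wpM2l// ler_wpM2r.
have -> : L * (4 * r * B%:R * d ^+ 2) = r * L * (B%:R * (2 * d) ^+ 2) by ring.
apply: (@le_trans _ _ (r * L * (M%:R * C))).
  by rewrite ler_wpM2l// mulr_ge0// ltW.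
have -> : r * L * (M%:R * C) = M%:R * (r * L) * C by ring.
have -> : 2 * C * l = 2 * l * C by ring.
by rewrite ler_wpM2r.
Qed.

End Chains.

(** The lower bound of order [L] given by the chains exceeds the upper bound of
    [energy_upper] once [L] is large. *)
Lemma row_const_right (x0 y0 l : R) : 0 < l ->
  (F (x0 + l, y0)).2 = (F (x0, y0)).2.
Proof.
move=> l0; apply/eqP; apply/negPn/negP => ne.
have [d d0 dE] : exists2 d : R, 0 < d &
    4 * d = `|(F (x0 + l, y0)).2 - (F (x0, y0)).2|.
  exists (`|(F (x0 + l, y0)).2 - (F (x0, y0)).2| / 4).
    by apply: divr_gt0 => //; rewrite normr_gt0 subr_eq0.
  by rewrite mulrC divfK.
have [t1 t10 ht1] := weak_qs_continuous (x0, y0) d0.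
have [t2 t20 ht2] := weak_qs_continuous (x0 + l, y0) d0.
have [t [t0 tt1 tt2]] : exists t : R, [/\ 0 < t, t <= t1 & t <= t2].
  exists (Num.min t1 t2); split; first by rewrite lt_min t10.
    by rewrite ge_min lexx.
  by rewrite ge_min lexx orbT.
have [C hC] := energy_upper (x0, y0) (l + t).
have [L [L1 Lt Ll Llt LC]] := choose_scale l0 t0 d0 (normr_ge0 C).
have [r [r0 rL LE]] := choose_radius L1.
have [r2 st sl rt] := mesh_bounds r0 L1 rL Lt Ll.
have s0 : 0 < r * L by rewrite mulr_gt0//; lra.
have [M M0 /andP[Ml Mu]] := nat_ceil (ltW l0) s0.
have r20 : 0 < 2 * r by lra.
(* [nat_ceil] gives the ceiling; the number of chains is one less, so that
   they fit below the height [t]. *)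
have [B1 B10 /andP[Bl' Bu']] := nat_ceil (ltW t0) r20.
case: B1 B10 Bl' Bu' => // B _; rewrite -natr1 mulrDl mul1r => Bl' Bu'.
have Bl : t <= 4 * r * B%:R by lra.
have Ms : l < M%:R * (r * L) <= l + t.
  by rewrite Ml (le_trans Mu)// lerD2l.
have Mu2 : M%:R * (r * L) <= 2 * l by lra.
have BM : (B + M)%:R * r <= t.
  have Mr : 2 * (M%:R * r) <= t.
    have L0 : 0 < L by lra.
    by rewrite -(ler_pM2r L0); lra.
  by rewrite natrD; lra.
have low b (bB : (b < B)%N) := chain_energy l0 t0 r0 L1 Ms BM bB d0
  (fun z h1 h2 => ht1 z (le_trans h1 tt1) (le_trans h2 tt1))
  (fun z h1 h2 => ht2 z (le_trans h1 tt2) (le_trans h2 tt2)) dE.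
have up := hC ('I_B * 'I_M)%type (fun i => chain x0 y0 r L M i.1 i.2)
  (fun i => chain x0 y0 r L M i.1 (nat_of_ord i.2).+1) r r0 r2.
have CC : C <= `|C| := ler_norm C.
have : L * (t * d ^+ 2) <= 2 * C * l.
  apply: (chains_energy r0 L1 d0 Bl Mu2 low).
  apply: up => //.
  - by move=> [b k] [b' k'] bk; exact: chain_separated.
  - by move=> [b k] /=; exact: chain_step.
  - move=> [b k] /=.
    have [h1 h2] := chain_box x0 y0 r0 L1 Ms BM (ltn_ord b) (ltnW (ltn_ord k)).
    case/andP: h1 => h1 h1'; case/andP: h2 => h2 h2'.
    rewrite !ger0_norm//; split; first exact: h1'.
    by apply: le_trans h2' _; rewrite lerDr ltW.
apply/negP; rewrite -ltNge; apply: le_lt_trans LC.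
by have := normr_ge0 C; rewrite ler_pM2r//; lra.
Qed.

Lemma row_const (x x' y : R) : (F (x, y)).2 = (F (x', y)).2.
Proof.
have [xx|xx|->//] := ltgtP x x'.
  by rewrite -(@row_const_right x y (x' - x)) ?subr_gt0// subrKC.
by rewrite -(@row_const_right x' y (x - x')) ?subr_gt0// subrKC.
Qed.

End Horizontal.

(** * Additive functions and the entropy of a subdivision *)

Section Real.
Variable R : realType.

Lemma ln_nat_unbounded (B : R) : exists2 n, (0 < n)%N & B < ln n%:R.
Proof.
exists (Num.truncn (expR B)).+1 => //.
have /truncn_itv/andP[_ h] : 0 <= expR B by exact: expR_ge0.
by rewrite -[B in B < _]expRK ltr_ln ?posrE ?expR_gt0// ltr0n.
Qed.

Lemma le0_of_ln_nat (s B : R) :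
  (forall n, (0 < n)%N -> s * ln n%:R <= B) -> s <= 0.
Proof.
move=> h; rewrite leNgt; apply/negP => s0.
have [n n0] := ln_nat_unbounded (B / s).
by rewrite ltr_pdivrMr// mulrC ltNge h.
Qed.

(** The difference [e] with the linear function is additive and vanishes on
    integers, so it is bounded on the half-line; the multiples of a nonzero
    value would not be. *)
Lemma additive_bounded_linear (f : R -> R) (B : R) :
  (forall x y, f (x + y) = f x + f y) ->
  (forall t, 0 <= t <= 1 -> `|f t| <= B) ->
  forall x, f x = f 1 * x.
Proof.
move=> fD fB.
pose e t := f t - f 1 * t.
have eD x y : e (x + y) = e x + e y by rewrite /e fD; ring.
have e0 : e 0 = 0 by have := eD 0 0; rewrite addr0; lra.
have eN x : e (- x) = - e x.
  by have := eD x (- x); rewrite subrr e0; lra.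
have eM n x : e (n%:R * x) = n%:R * e x.
  elim: n => [|n IH]; first by rewrite !mul0r e0.
  by rewrite -natr1 !mulrDl !mul1r eD IH.
have e1 : e 1 = 0 by rewrite /e; ring.
pose B' := B + `|f 1|.
have eB t : 0 <= t -> `|e t| <= B'.
  move=> /truncn_itv; set n := Num.truncn t => /andP[h1 h2].
  have -> : e t = e (t - n%:R).
    rewrite eD eN -[X in - e X]mulr1 eM e1; ring.
  rewrite -natr1 in h2.
  have tn : 0 <= t - n%:R <= 1 by lra.
  apply: le_trans (ler_normB _ _) _; apply: lerD; first exact: fB.
  rewrite normrM ler_piMr// ger0_norm; lra.
have e0' t : 0 <= t -> e t = 0.
  move=> t0; apply/eqP/negPn/negP => et.
  have et0 : 0 < `|e t| by rewrite normr_gt0.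
  have : 0 <= B' / `|e t|.
    by apply: divr_ge0 => //; apply: le_trans (eB _ t0).
  move=> /truncn_itv; set n := Num.truncn _ => /andP[_].
  rewrite ltr_pdivrMr// ltNge => /negP; apply.
  have <- : `|e (n.+1%:R * t)| = n.+1%:R * `|e t|.
    by rewrite eM normrM normr_nat.
  by apply: eB; rewrite mulr_ge0.
move=> x; apply/eqP; rewrite -subr_eq0; apply/eqP; rewrite -/(e x).
have [x0|x0] := leP 0 x; first exact: e0'.
by apply: oppr_inj; rewrite -eN e0' ?oppr0//; lra.
Qed.

(** The horizontal displacement along the loop of shortest steps [(xlnx v, v)]
    that climbs through the heights [t 0, ..., t n] and returns in one step.
    When [t] is increasing this is [- (t n - t 0)] times the Shannon entropy of
    the proportions of the steps. *)
Definition gain (t : nat -> R) n :=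
  \sum_(i < n) xlnx (t i.+1 - t i) - xlnx (t n - t 0%N).

Lemma sum_steps (t : nat -> R) n : \sum_(i < n) (t i.+1 - t i) = t n - t 0%N.
Proof.
by rewrite -(telescope_sumr t (leq0n n)) big_mkord.
Qed.

Lemma gain_arith a s n : 0 < s -> (0 < n)%N ->
  gain (fun i => a + i%:R * s) n = - (n%:R * s * ln n%:R).
Proof.
move=> s0 n0; rewrite /gain.
have np : 0 < n%:R :> R by rewrite ltr0n.
have -> : a + n%:R * s - (a + 0%:R * s) = n%:R * s by ring.
rewrite (eq_bigr (fun=> xlnx s)).
  rewrite sumr_const card_ord -[xlnx s *+ n]mulr_natl.
  rewrite !xlnx_pos ?mulr_gt0// lnM ?posrE//; ring.
by move=> i _; congr xlnx; rewrite -natr1; ring.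
Qed.

Lemma gain_le0 (t : nat -> R) n : (forall i, (i < n)%N -> t i < t i.+1) ->
  gain t n <= 0.
Proof.
move=> tS; rewrite /gain subr_le0.
set v := t n - t 0%N.
have d0 (i : 'I_n) : 0 < t i.+1 - t i by rewrite subr_gt0; exact: tS.
have dv (i : 'I_n) : t i.+1 - t i <= v.
  rewrite /v -(sum_steps t n) (bigD1 i)//= lerDl sumr_ge0// => j _.
  exact/ltW/d0.
have -> : xlnx v = \sum_(i < n) (t i.+1 - t i) * ln v.
  rewrite -mulr_suml sum_steps -/v.
  have [v0|v0] := ltrP 0 v; first by rewrite xlnx_pos.
  have -> : v = 0.
    apply/eqP; rewrite eq_le v0 /v -(sum_steps t n) sumr_ge0// => j _.
    exact/ltW/d0.
  by rewrite xlnx0 mul0r.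
apply: ler_sum => i _; rewrite xlnx_pos// ler_pM2l// ler_ln// ?posrE//.
exact: lt_le_trans (dv i).
Qed.

(** Entropy is at most [ln n]; summed over the steps [u], the tangent inequality
    [ln (v / n / u) <= v / n / u - 1] gives it. *)
Lemma gain_ge (t : nat -> R) n : (0 < n)%N ->
  (forall i, (i < n)%N -> t i < t i.+1) ->
  - ((t n - t 0%N) * ln n%:R) <= gain t n.
Proof.
move=> n0 tS; rewrite /gain.
have np : 0 < n%:R :> R by rewrite ltr0n.
set v := t n - t 0%N.
have d0 (i : 'I_n) : 0 < t i.+1 - t i by rewrite subr_gt0; exact: tS.
have v0 : 0 < v.
  rewrite /v -(sum_steps t n); case: n n0 {tS np v} d0 => // n _ d0.
  rewrite big_ord_recl; apply: ltr_wpDr (d0 ord0).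
  by apply: sumr_ge0 => j _; exact/ltW/d0.
have vn0 : 0 < v / n%:R by exact: divr_gt0.
have step (i : 'I_n) : (t i.+1 - t i) * ln (v / n%:R) -
    (v / n%:R - (t i.+1 - t i)) <= xlnx (t i.+1 - t i).
  move: (t i.+1 - t i) (d0 i) => u u0.
  rewrite xlnx_pos//.
  have q0 : 0 < v / n%:R / u by exact: divr_gt0.
  have : ln (v / n%:R / u) <= v / n%:R / u - 1.
    have := @le_ln1Dx R (v / n%:R / u - 1).
    by rewrite (addrC 1) subrK; apply; lra.
  rewrite ln_div ?posrE// -(ler_pM2l u0) mulrBr mulrBr mulr1.
  by rewrite (mulrC u (v / n%:R / u)) divfK ?gt_eqF//; lra.
have : \sum_(i < n) ((t i.+1 - t i) * ln (v / n%:R) -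
    (v / n%:R - (t i.+1 - t i))) <= \sum_(i < n) xlnx (t i.+1 - t i).
  by apply: ler_sum => i _.
rewrite sumrB -mulr_suml sum_steps sumrB sum_steps -/v.
rewrite sumr_const card_ord -[X in _ - (X - _)]mulr_natl.
rewrite (mulrC n%:R) divfK ?gt_eqF// subrr subr0 ln_div ?posrE//.
rewrite xlnx_pos//; lra.
Qed.

End Real.

(** * Rigidity of maps preserving horizontal lines *)
Section Rigidity.
Variable R : realType.
Variables (F G : R * R -> R * R).
Hypotheses (FG : cancel F G) (GF : cancel G F).
Hypothesis qsF : weak_qs (D R) (D R) F.

Definition height (y : R) : R := (F (0, y)).2.

Lemma F_height x y : (F (x, y)).2 = height y.
Proof. exact: (row_const FG GF qsF). Qed.

Lemma FE x y : F (x, y) = ((F (x, y)).1, height y).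
Proof.
by rewrite [LHS]surjective_pairing F_height.
Qed.

Lemma G_row x x' y : (G (x, y)).2 = (G (x', y)).2.
Proof. exact: (row_const GF FG (weak_qs_inv FG GF qsF)). Qed.

Lemma height_inv Y : height (G (0, Y)).2 = Y.
Proof.
by have := congr1 snd (GF (0, Y)); rewrite [G _]surjective_pairing FE.
Qed.

(** The inverse map preserves horizontal lines as well. *)
Lemma height_inj : injective height.
Proof.
move=> y y' e.
have h z : (G ((F (0, z)).1, height z)).2 = z by rewrite -FE FG.
by have := h y; rewrite e (G_row _ (F (0, y')).1) h.
Qed.

Lemma G_height X y : (G (X, height y)).2 = y.
Proof. by apply: height_inj; rewrite (G_row X 0) height_inv. Qed.

Lemma height_near y e : 0 < e -> exists2 t : R, 0 < t & forall y',
  `|y' - y| <= t -> `|height y' - height y| <= e.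
Proof.
move=> e0; have [t t0 ht] := weak_qs_continuous qsF (0, y) e0.
exists t => // y' yy; apply: le_trans (D_ge2 (F (0, y)) (F (0, y'))) _.
by apply: ht => //=; rewrite subrr normr0 ltW.
Qed.

Lemma height_mono : {homo height : s t / s < t} \/ {homo height : s t /~ s < t}.
Proof.
have ch : {within [set` `]-oo, +oo[ : interval R], continuous height}.
  rewrite set_itvE; apply/continuous_subspaceT => y.
  apply/cvgrPdist_le => e e0; have [t t0 ht] := height_near y e0.
  near=> y'; rewrite distrC; apply: ht.
  rewrite distrC; near: y'; apply/nbhs_normP; by exists t => // z /= /ltW.
have [h|h] := itv_continuous_inj_mono ch (in2W height_inj).
  by left=> s t; apply: h; rewrite in_itv.
by right=> s t; apply: h; rewrite in_itv.
Unshelve. all: by end_near. Qed.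

(** The source pair realises the distance between the rows of heights [t] and
    [t'], and its image is compared with a pair that realises the distance
    between the image rows. *)
Lemma one_step : exists2 C : R, 0 < C & forall x t t',
  `|(F (x + xlnx (t' - t), t')).1 - (F (x, t)).1 - xlnx (height t' - height t)|
  <= C * `|height t' - height t|.
Proof.
have [C C0 hC] := qsF.1 1; exists C => // x t t'.
set s := height t' - height t.
pose z := G ((F (x, t)).1 + xlnx s, height t').
have h1 : D R (x, t) (x + xlnx (t' - t), t') <= 1 * D R (x, t) z.
  rewrite mul1r; apply: (@le_trans _ _ `|t' - t|).
    by rewrite D_le /= (addrC x) addrK subrr normr0 lexx normr_ge0.
  by have := D_ge2 (x, t) z; rewrite /z G_height.
have := hC _ _ _ h1; rewrite GF.
have -> : D R (F (x, t)) ((F (x, t)).1 + xlnx s, height t') = `|s|.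
  rewrite /= /D_fun /= F_height -/s.
  by rewrite (addrC _ (xlnx s)) addrK subrr normr0; apply/max_idPl.
apply: le_trans; have := D_ge1 (F (x, t)) (F (x + xlnx (t' - t), t')).
by rewrite !F_height.
Qed.

Section Increasing.
Hypothesis heightS : {homo height : s t / s < t}.

Lemma height_le s t : s <= t -> height s <= height t.
Proof. by rewrite le_eqVlt => /predU1P[->//|/heightS/ltW]. Qed.

Lemma height_lt s t : height s < height t -> s < t.
Proof.
by move=> st; rewrite ltNge; apply/negP => /height_le; rewrite leNgt st.
Qed.

Lemma dist_chain (a b c d e X Y : R) :
  `|a - b - d| <= X -> `|c - a - e| <= Y -> `|c - b - (d + e)| <= X + Y.
Proof.
move=> h1 h2; apply: le_trans (lerD h1 h2).
have -> : c - b - (d + e) = (a - b - d) + (c - a - e) by ring.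
exact: ler_normD.
Qed.

(** Sum of [one_step] around a closed loop of heights.  The error is
    independent of [n] because the steps of [height] add up to its total
    increase. *)
Lemma loop : exists2 C : R, 0 < C & forall x (t : nat -> R) n,
  (forall i, (i < n)%N -> t i < t i.+1) ->
  `|(F (x + gain t n, t 0)).1 - (F (x, t 0)).1 - gain (height \o t) n|
  <= C * (height (t n) - height (t 0)).
Proof.
have [C C0 hC] := one_step; exists (2 * C); first by rewrite mulr_gt0.
move=> x t n tS.
have t0n m : (m <= n)%N -> height (t 0) <= height (t m).
  elim: m => // m IH mn; apply: (le_trans (IH (ltnW mn))).
  exact/ltW/heightS/tS.
have up m : (m <= n)%N ->
    `|(F (x + \sum_(i < m) xlnx (t i.+1 - t i), t m)).1 - (F (x, t 0)).1 -
      \sum_(i < m) xlnx (height (t i.+1) - height (t i))|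
    <= C * (height (t m) - height (t 0)).
  elim: m => [|m IH] mn.
    by rewrite !big_ord0 addr0 !subrr normr0 mulr0.
  have h1 := IH (ltnW mn).
  rewrite !big_ord_recr /= addrA.
  apply: le_trans (dist_chain h1 (hC _ (t m) (t m.+1))) _.
  rewrite [X in _ + C * X]ger0_norm ?subr_ge0 ?(ltW (heightS (tS _ mn)))//.
  by rewrite -mulrDr addrC addrA subrK.
rewrite /gain /= addrA.
have -> : xlnx (t n - t 0) = - xlnx (t 0 - t n) by rewrite -xlnxN opprB.
have -> : xlnx (height (t n) - height (t 0)) =
    - xlnx (height (t 0) - height (t n)) by rewrite -xlnxN opprB.
rewrite !opprK.
apply: le_trans (dist_chain (up n (leqnn _)) (hC _ (t n) (t 0))) _.
by rewrite distrC ger0_norm ?subr_ge0 ?t0n//; lra.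
Qed.
(** The displacement [- v ln n] has an image that is, up to the error, a
    number [W] independent of the point of the row, and the entropy bound
    controls [W]. *)
Lemma equal_steps : exists2 C : R, 0 < C & forall y v n, 0 < v -> (0 < n)%N ->
  exists2 W, - W <= (height (y + v) - height y) * ln n%:R &
  forall x, `|(F (x - v * ln n%:R, y)).1 - (F (x, y)).1 - W| <=
    C * (height (y + v) - height y).
Proof.
have [C C0 hC] := loop; exists C => // y v n v0 n0.
have np : 0 < n%:R :> R by rewrite ltr0n.
pose t i : R := y + i%:R * (v / n%:R).
have vn0 : 0 < v / n%:R by rewrite divr_gt0.
have t0 : t 0%N = y by rewrite /t mul0r addr0.
have tn : t n = y + v by rewrite /t mulrC divfK ?gt_eqF.
have tS i : t i < t i.+1 by rewrite /t ltrD2l ltr_pM2r// ltr_nat.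
exists (gain (height \o t) n).
  rewrite lerNl -tn -t0; apply: (@gain_ge R (height \o t)) => // i _.
  exact: heightS.
move=> x; have := hC x t n (fun i _ => tS i); rewrite t0 tn.
by rewrite gain_arith// (mulrC n%:R) divfK ?gt_eqF.
Qed.

(** The mirror image of [equal_steps]: the steps are now equal in the target,
    where the displacement is known exactly, while it is only bounded in the
    source. *)
Lemma equal_image_steps : exists2 C : R, 0 < C &
  forall y v n, 0 < v -> (0 < n)%N ->
  exists2 w, 0 <= w <= v * ln n%:R &
  forall x, `|(F (x - w, y)).1 - (F (x, y)).1 +
      (height (y + v) - height y) * ln n%:R| <=
    C * (height (y + v) - height y).
Proof.
have [C C0 hC] := loop; exists C => // y v n v0 n0.
have np : 0 < n%:R :> R by rewrite ltr0n.
set S := height (y + v) - height y.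
have S0 : 0 < S by rewrite subr_gt0; apply: heightS; rewrite ltrDl.
have Sn0 : 0 < S / n%:R by rewrite divr_gt0.
pose t i : R := (G (0, height y + i%:R * (S / n%:R))).2.
have ht i : height (t i) = height y + i%:R * (S / n%:R) by exact: height_inv.
have t0 : t 0%N = y by rewrite /t mul0r addr0 G_height.
have tn : t n = y + v.
  by rewrite /t mulrC divfK ?gt_eqF// /S subrKC G_height.
have tS i : t i < t i.+1.
  by apply: height_lt; rewrite !ht ltrD2l ltr_pM2r// ltr_nat.
exists (- gain t n).
  rewrite oppr_ge0 gain_le0//= lerNl.
  have -> : v = t n - t 0%N by rewrite tn t0 addrC addKr.
  exact: gain_ge.
move=> x; have := hC x t n (fun i _ => tS i); rewrite t0 tn opprK.
have -> : gain (height \o t) n =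
    gain (fun i => height y + i%:R * (S / n%:R)) n.
  rewrite /gain /= !ht; congr (_ - _).
  by apply: eq_bigr => i _; rewrite !ht.
by rewrite gain_arith// (mulrC n%:R) divfK ?gt_eqF// opprK.
Qed.

(** Keep [v ln n = l] fixed while [v] tends to 0: the error of [equal_steps],
    a multiple of [height (y + v) - height y], vanishes in the limit. *)
Lemma translation_const y x x' l : 0 < l ->
  (F (x - l, y)).1 - (F (x, y)).1 = (F (x' - l, y)).1 - (F (x', y)).1.
Proof.
move=> l0; apply/eqP; rewrite -subr_eq0 -normr_le0.
apply/ler_addgt0Pr => e e0; rewrite add0r.
have [C C0 hC] := equal_steps.
have e2 : 0 < e / (2 * C) by rewrite divr_gt0// mulr_gt0.
have [t t0 ht] := height_near y e2.
have [n n0 hn] := ln_nat_unbounded (l / t).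
have ln0 : 0 < ln n%:R :> R by apply: lt_trans hn; exact: divr_gt0.
have v0 : 0 < l / ln n%:R by exact: divr_gt0.
have [W _ hW] := hC y _ n v0 n0.
have := hW x; have := hW x'; rewrite divfK ?gt_eqF//.
set S := height _ - height _.
have hS : C * S <= e / 2.
  have : S <= e / (2 * C).
    apply: le_trans (ler_norm _) (ht _ _).
    rewrite addrC addKr gtr0_norm// ler_pdivrMr// mulrC -ler_pdivrMr//.
    exact: ltW.
  rewrite -(ler_pM2l C0) => /le_trans; apply.
  by rewrite le_eqVlt; apply/orP; left; apply/eqP; field; rewrite gt_eqF.
move: (F (x - l, y)).1 (F (x, y)).1 (F (x' - l, y)).1 (F (x', y)).1.
move=> a b c d h1 h2.
apply: (@le_trans _ _ (e / 2 + e / 2)); last lra.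
apply: le_trans (lerD (le_trans h2 hS) (le_trans h1 hS)).
have -> : a - b - (c - d) = (a - b - W) - (c - d - W) by ring.
exact: ler_normB.
Qed.

Lemma row_affine x y :
  (F (x, y)).1 = ((F (1, y)).1 - (F (0, y)).1) * x + (F (0, y)).1.
Proof.
pose f x := (F (x, y)).1 - (F (0, y)).1.
have [C1 _ hC1] := qsF.1 1.
suff -> : (F (x, y)).1 = f x + (F (0, y)).1.
  congr (_ + _).
  apply: (@additive_bounded_linear R f (C1 * D R (F (0, y)) (F (1, y)))).
    have fB a l : 0 < l -> f (a - l) = f a + f (- l).
      move=> l0; have := @translation_const y a 0 l l0.
      by rewrite /f sub0r; lra.
    have f0 : f 0 = 0 by rewrite /f subrr.
    have fN l : 0 < l -> f (- l) = - f l.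
      by move=> l0; have := fB l l l0; rewrite subrr f0; lra.
    move=> a b; have [b0|b0|->] := ltgtP b 0.
    - by have := fB a (- b); rewrite opprK oppr_gt0; apply.
    - by have := fB (a + b) b b0; rewrite addrK fN//; lra.
    - by rewrite f0 !addr0.
  move=> s /andP[s0 s1]; have : D R (0, y) (s, y) <= 1 * D R (0, y) (1, y).
    by rewrite !D_row !subr0 mul1r normr1 ger0_norm.
  move=> /hC1; apply: le_trans.
  by have := D_ge1 (F (0, y)) (F (s, y)); rewrite !F_height subrr xlnx0 subr0.
by rewrite /f subrK.
Qed.

(** Both comparisons are divided by [ln n], whose growth kills the bounded
    errors: [equal_steps] gives one inequality, [equal_image_steps] the other,
    and also the positivity of the slope of the row. *)
Lemma height_slope y v : 0 < v ->
  height (y + v) - height y = ((F (1, y)).1 - (F (0, y)).1) * v.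
Proof.
move=> v0; set S := _ - height y; set a := _ - (F (0, y)).1.
have S0 : 0 < S by rewrite subr_gt0; apply: heightS; rewrite ltrDl.
have row x : (F (x, y)).1 = a * x + (F (0, y)).1 by exact: row_affine.
have [C C0 hC] := equal_steps; have [C' C'0 hC'] := equal_image_steps.
have up n : (0 < n)%N -> (a * v - S) * ln n%:R <= C * S.
  move=> n0; have [W hW /(_ 0)] := hC y v n v0 n0.
  rewrite -/S sub0r (row (- _)) ler_norml => /andP[h _].
  by rewrite -/S in hW; lra.
have low n : (0 < n)%N -> exists2 w, 0 <= w <= v * ln n%:R &
    S * ln n%:R - C' * S <= a * w.
  move=> n0; have [w hw /(_ 0)] := hC' y v n v0 n0.
  rewrite -/S sub0r (row (- _)) ler_norml => /andP[_ h].
  by exists w => //; lra.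
have a0 : 0 < a.
  have [n n0 hn] := ln_nat_unbounded C'.
  have [w /andP[w0 _] hw] := low n n0.
  rewrite ltNge; apply/negP => a0.
  have : a * w <= 0 by rewrite mulr_le0_ge0.
  have : 0 < S * (ln n%:R - C') by rewrite mulr_gt0// subr_gt0.
  lra.
apply/eqP; rewrite eq_le -subr_le0 -[a * v <= S]subr_le0.
apply/andP; split; last exact: le0_of_ln_nat up.
apply: (@le0_of_ln_nat _ _ (C' * S)) => n n0.
have [w /andP[_ w1] hw] := low n n0.
have : a * w <= a * (v * ln n%:R) by rewrite ler_pM2l.
lra.
Qed.

Lemma affine_form_increasing : exists (a b : R) (c : R -> R),
  [/\ a != 0, exists K : R, forall y y', `|c y - c y'| <= K * `|y - y'| &
    forall x y, F (x, y) = (a * x + c y, a * y + b)].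
Proof.
pose s y := (F (1, y)).1 - (F (0, y)).1.
have hs y v : 0 < v -> height (y + v) - height y = s y * v.
  exact: height_slope.
(* Slopes based at [y] and at 0 agree on the heights above both. *)
have sE y : s y = s 0.
  have h01 : 0 < 1 :> R by [].
  have h0 := hs 0 1 h01; have h1 := hs y 1 h01; rewrite add0r in h0.
  have [y0|y0|->//] := ltgtP y 0.
    have ny : 0 < - y by lra.
    have ny1 : 0 < 1 - y by lra.
    have := hs y (- y) ny; have := hs y (1 - y) ny1.
    by rewrite subrr subrKC; lra.
  have y1 : 0 < y + 1 by lra.
  by have := hs 0 y y0; have := hs 0 (y + 1) y1; rewrite !add0r; lra.
have hE y : height y = s 0 * y + height 0.
  have [y0|y0|->] := ltgtP y 0.
  - have ny : 0 < - y by lra.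
    by have := hs y (- y) ny; rewrite subrr sE; lra.
  - by have := hs 0 y y0; rewrite add0r; lra.
  - by rewrite mulr0 add0r.
have gE x y : (F (x, y)).1 = s 0 * x + (F (0, y)).1.
  by rewrite row_affine -/(s y) sE.
have [C C0 hC] := one_step.
exists (s 0), (height 0), (fun y => (F (0, y)).1); split.
- apply/eqP => s0; have : height 0 < height 1 by exact: heightS.
  by rewrite (hE 1) s0; lra.
- exists (C * `|s 0| + `|xlnx (s 0)|) => y y'.
  have := hC 0 y' y; rewrite add0r gE.
  rewrite (hE y) (hE y') opprD addrACA subrr addr0 -mulrBr xlnxM normrM.
  set u := _ - _.
  move: (F (0, y)).1 (F (0, y')).1 => p q h.
  rewrite mulrDl -mulrA.
  apply: le_trans (lerD h (lexx _)).
  have -> : p - q = (s 0 * xlnx (y - y') + p - q -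
    (s 0 * xlnx (y - y') + (y - y') * xlnx (s 0))) +
    (y - y') * xlnx (s 0) by ring.
  by apply: le_trans (ler_normD _ _) _; rewrite lerD2l normrM mulrC.
- by move=> x y; rewrite FE gE hE.
Qed.

End Increasing.

End Rigidity.

(** * The normal form and the converse *)

Section Forms.
Variable R : realType.

Lemma lipschitz_exP (c : R -> R) :
  lipschitz c <-> exists K : R, forall y y', `|c y - c y'| <= K * `|y - y'|.
Proof.
split=> [cL|[K hK]].
  have [K hK] := filter_ex (cL : \forall M \near +oo, M.-lipschitz c).
  by exists K => y y'; exact: (hK (y, y')).
rewrite /lipschitz_on; near=> M.
case=> y y' _; apply: (le_trans (hK y y')).
rewrite ler_wpM2r//; near: M; apply: nbhs_pinfty_ge; exact: num_real.
Unshelve. all: by end_near. Qed.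

Definition opp2 (p : R * R) : R * R := (- p.1, - p.2).

Lemma opp2K : involutive opp2.
Proof. by move=> [x y]; rewrite /opp2 /= !opprK. Qed.

Lemma D_opp2 p q : D R (opp2 p) (opp2 q) = D R p q.
Proof.
rewrite /= /D_fun /= -!opprD !normrN; congr (Num.max _ _).
by rewrite mulNr.
Qed.

(** The reflection [p |-> - p] is an isometry of [D], which reduces a decreasing
    [height] to an increasing one. *)
Lemma weak_qs_form (F G : R * R -> R * R) : cancel F G -> cancel G F ->
  weak_qs (D R) (D R) F ->
  exists (a b : R) (c : R -> R), [/\ a != 0, lipschitz c &
    forall x y, F (x, y) = (a * x + c y, a * y + b)].
Proof.
move=> FG GF qsF.
have [inc|dec] := height_mono FG GF qsF.
  have [a [b [c [a0 cL Fabc]]]] := affine_form_increasing FG GF qsF inc.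
  by exists a, b, c; split => //; exact/lipschitz_exP.
have FG' : cancel (opp2 \o F) (G \o opp2) by move=> p /=; rewrite opp2K FG.
have GF' : cancel (G \o opp2) (opp2 \o F) by move=> p /=; rewrite GF opp2K.
have qsF' : weak_qs (D R) (D R) (opp2 \o F).
  case: qsF => q1 q2; split=> [K|e e0].
    have [C C0 hC] := q1 K; exists C => // p q z.
    by rewrite /comp !D_opp2; exact: hC.
  have [d d0 hd] := q2 e e0; exists d => // p q z.
  by rewrite /comp !D_opp2; exact: hd.
have inc : {homo height (opp2 \o F) : s t / s < t}.
  by move=> s t st; rewrite /height /= ltrN2; exact: dec.
have [a [b [c [a0 [K cL] Fabc]]]] := affine_form_increasing FG' GF' qsF' inc.
exists (- a), (- b), (fun y => - c y); split; first by rewrite oppr_eq0.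
  apply/lipschitz_exP; exists K => y y'.
  by rewrite -opprD normrN.
move=> x y; have := congr1 opp2 (Fabc x y); rewrite /comp opp2K => ->.
by rewrite /opp2 /= !opprD !mulNr.
Qed.

(** By [xlnxM] the map multiplies [u - xlnx v] by [a] up to an error of at most
    [(K + |xlnx a|) |v|], where [K] is a Lipschitz constant of [c]. *)
Lemma form_biLipschitz (F : R * R -> R * R) (a b : R) (c : R -> R) :
  bijective F -> a != 0 -> lipschitz c ->
  (forall x y, F (x, y) = (a * x + c y, a * y + b)) ->
  biLipschitz (D R) (D R) F.
Proof.
move=> bF a0 /lipschitz_exP[K cK] FE; split => //.
have A0 : 0 < `|a| by rewrite normr_gt0.
set A := `|a| in A0 *.
pose E := `|xlnx a| + `|K|.
have E0 : 0 <= E by rewrite addr_ge0.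
have AE0 : 0 <= E / A by rewrite divr_ge0// ltW.
have iA0 : 0 < A^-1 by rewrite invr_gt0.
have iAE0 : 0 <= A^-1 * (E / A) by rewrite mulr_ge0// ltW.
(* The shear [c] and the factor [a] inside the logarithm together contribute
   an error [w] of at most [E |y' - y|]. *)
have key x y x' y' : exists2 w, `|w| <= E * `|y' - y| &
    (F (x', y')).1 - (F (x, y)).1 - xlnx ((F (x', y')).2 - (F (x, y)).2) =
    a * (x' - x - xlnx (y' - y)) + w.
  exists (c y' - c y - (y' - y) * xlnx a).
    apply: le_trans (ler_normB _ _) _.
    rewrite /E [leRHS]mulrDl addrC; apply: lerD; first by rewrite normrM mulrC.
    by apply: le_trans (cK _ _) _; rewrite ler_wpM2r// ler_norm.
  rewrite !FE /=.
  have -> : a * y' + b - (a * y + b) = a * (y' - y) by ring.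
  by rewrite xlnxM; ring.
have Fy_dist x y x' y' : `|(F (x', y')).2 - (F (x, y)).2| = A * `|y' - y|.
  by rewrite !FE /= -normrM; congr `|_|; ring.
exists (1 + A + E + A^-1 + A^-1 * (E / A)); first lra.
move=> [x y] [x' y'].
have [w hw wE] := key x y x' y'.
have h1 : `|x' - x - xlnx (y' - y)| <= D R (x, y) (x', y').
  exact: D_ge1 (x, y) (x', y').
have h2 : `|y' - y| <= D R (x, y) (x', y') by exact: D_ge2 (x, y) (x', y').
have f1 := D_ge1 (F (x, y)) (F (x', y')).
have f2 := D_ge2 (F (x, y)) (F (x', y')).
rewrite Fy_dist in f2; rewrite wE in f1.
split.
  rewrite ler_pdivrMr; last lra.
  have f2' : `|y' - y| <= A^-1 * D R (F (x, y)) (F (x', y')).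
    by rewrite ler_pdivlMl.
  have dF0 := qdist_ge0 (D R) (F (x, y)) (F (x', y')).
  move: f1 f2 f2' dF0; move: (D R (F _) _) => d f1 f2 f2' d0.
  have d1 : 0 <= A * d by rewrite mulr_ge0// ltW.
  have d2 : 0 <= A^-1 * d by rewrite mulr_ge0// ltW.
  have d3 : 0 <= A^-1 * (E / A) * d by rewrite mulr_ge0.
  have d4 : 0 <= E * d by rewrite mulr_ge0.
  rewrite D_le; apply/andP; split => /=; first lra.
  have hw' : `|w| <= E * (A^-1 * d) by apply: le_trans hw _; rewrite ler_wpM2l.
  have : `|a * (x' - x - xlnx (y' - y))| <= d + E * (A^-1 * d).
    rewrite -[X in `|X|](addrK w).
    by apply: le_trans (ler_normB _ _) _; exact: lerD.
  rewrite normrM -/A -ler_pdivlMl// => /le_trans; apply.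
  lra.
have dX0 := qdist_ge0 (D R) (x, y) (x', y').
move: h1 h2 dX0; move: (D R (x, y) _) => d h1 h2 d0.
have d1 : 0 <= A * d by rewrite mulr_ge0// ltW.
have d2 : 0 <= A^-1 * d by rewrite mulr_ge0// ltW.
have d3 : 0 <= A^-1 * (E / A) * d by rewrite mulr_ge0.
have d4 : 0 <= E * d by rewrite mulr_ge0.
rewrite D_le Fy_dist wE; apply/andP; split.
  have : A * `|y' - y| <= A * d by rewrite ler_pM2l.
  lra.
apply: le_trans (ler_normD _ _) _; rewrite normrM -/A.
have hw' : `|w| <= E * d by apply: le_trans hw _; rewrite ler_wpM2l.
have : A * `|x' - x - xlnx (y' - y)| <= A * d by rewrite ler_pM2l.
lra.
Qed.

Lemma homeo_scale (k : R) : 0 < k ->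
  homeomorphism_on (@nonneg_reals R) (@nonneg_reals R) ( *%R k).
Proof.
move=> k0; exists ( *%R k^-1); split.
- by move=> t; apply: mulr_ge0; exact: ltW.
- by move=> t; apply: mulr_ge0; rewrite invr_ge0 ltW.
- by split=> t _; [rewrite mulKf// gt_eqF|rewrite mulVKf// gt_eqF].
- by apply: continuous_subspaceT; exact: mulrl_continuous.
- by apply: continuous_subspaceT; exact: mulrl_continuous.
Qed.

Lemma biLipschitz_quasisymmetric (X Y : Type) (dX : quasimetric R X)
    (dY : quasimetric R Y) (F : X -> Y) :
  biLipschitz dX dY F -> quasisymmetric dX dY F.
Proof.
move=> [bF [L L1 hL]].
have L0 : 0 < L by lra.
exists ( *%R (L ^+ 2)); split; first by apply: homeo_scale; rewrite exprn_gt0.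
split=> // x y z xy yz xz.
have [h1 _] := hL x z; have [_ h2] := hL x y.
have xz0 := qdist_gt0 dX xz.
have Fxz0 : 0 < dY (F x) (F z) by apply: qdist_gt0 => /(bij_inj bF).
rewrite ler_pdivrMr//; apply: (le_trans h2).
have -> : L * dX x y = L ^+ 2 * (dX x y / dX x z) * (dX x z / L).
  by field; rewrite !gt_eqF.
by rewrite ler_wpM2l// mulr_ge0 ?sqr_ge0// divr_ge0 ?qdist_ge0.
Qed.

End Forms.

Theorem theorem1p1 (R : realType) :
  (forall F : R * R -> R * R,
     quasisymmetric (D R) (D R) F -> biLipschitz (D R) (D R) F)
  /\
  (forall F : R * R -> R * R, bijective F ->
     (quasisymmetric (D R) (D R) F <->
      exists (a b : R) (c : R -> R),
        [/\ a != 0, lipschitz c &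
            forall x y : R, F (x, y) = (a * x + c y, a * y + b)])).
Proof.
have form (F : R * R -> R * R) : bijective F ->
    quasisymmetric (D R) (D R) F -> exists (a b : R) (c : R -> R),
    [/\ a != 0, lipschitz c &
      forall x y : R, F (x, y) = (a * x + c y, a * y + b)].
  by move=> [G FG GF] /quasisymmetric_weak; exact: weak_qs_form FG GF.
split=> [F qs|F bF].
  have bF : bijective F by case: qs => eta [_ []].
  have [a [b [c [a0 cL FE]]]] := form F bF qs.
  exact: form_biLipschitz bF a0 cL FE.
split=> [|[a [b [c [a0 cL FE]]]]]; first exact: form.
exact/biLipschitz_quasisymmetric/(form_biLipschitz bF a0 cL FE).
Qed.
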